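(* Let $T:\mathcal{S}_n\to \mathcal{S}_n$ be an isometry (not assumed a priori to be surjective) with respect to the Hausdorff distance $\delta$, i.e. $\delta(TK,TL)=\delta(K,L)$ for all $K,L\in\mathcal{S}_n$. Then there exists a rigid motion $g:\mathbb{R}^n\to\mathbb{R}^n$ such that either $TK = gK$ for all $K\in \mathcal{S}_n$, or $TK = gK^c$ for all $K\in \mathcal{S}_n$.
   Context: Let $n\ge 1$ be an integer, let $B_2^n$ be the closed Euclidean unit ball in $\mathbb{R}^n$, and let $\mathcal{K}^n$ be the class of convex bodies, i.e. non-empty compact convex subsets of $\mathbb{R}^n$ (empty interior is allowed). The class of ball-bodies $\mathcal{S}_n\subseteq\mathcal{K}^n$ consists of all convex bodies which are intersections of translates $x+B_2^n$ of the unit ball; in particular $\emptyset,\mathbb{R}^n\notin\mathcal{S}_n$. Equivalently, $\mathcal{S}_n$ is the class of all $K\in\mathcal{K}^n$ for which there is $L\in\mathcal{K}^n$ with $K+L=B_2^n$ (Minkowski sum). The Hausdorff metric is $$\delta(K,L)=\inf\{\lambda>0 : K+\lambda B_2^n\supseteq L \text{ and } L+\lambda B_2^n\supseteq K\}.$$ For $K\in\mathcal{S}_n$, the $c$-dual $K^c\in\mathcal{S}_n$ is the unique $L\in\mathcal{S}_n$ such that $K-L=B_2^n$ (where $K-L=\{x-y: x\in K, y\in L\}$); equivalently, $K^c=\bigcap_{x\in K}(x+B_2^n)$. A rigid motion of $\mathbb{R}^n$ is a composition of an orthogonal transformation and a translation; $gK=\{g(x):x\in K\}$, and $gK^c$ means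 $g(K^c)$. *)

(* Defs.v *)
From HB Require Import structures.
From mathcomp Require Import all_boot all_order all_algebra.
From mathcomp Require Import all_classical all_reals all_analysis.

Set Implicit Arguments.
Unset Strict Implicit.
Unset Printing Implicit Defensive.

Import Order.TTheory GRing.Theory Num.Theory.
Import numFieldNormedType.Exports.

Local Open Scope classical_set_scope.
Local Open Scope ring_scope.

(* R^n is 'rV[R]_n. The library norm `|x| on 'rV[R]_n is the sup norm, so the
   Euclidean norm is defined here; both induce the topology of 'rV[R]_n. *)
Definition enorm (R : realType) (n : nat) (x : 'rV[R]_n) : R :=
  Num.sqrt (\sum_(i < n) x ord0 i ^+ 2).

Definition unit_ball (R : realType) (n : nat) : set 'rV[R]_n :=
  [set x | enorm x <= 1].

Definition translate (R : realType) (n : nat) (x : 'rV[R]_n)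
  (K : set 'rV[R]_n) : set 'rV[R]_n := [set x + y | y in K].

Definition dilate (R : realType) (n : nat) (lambda : R)
  (K : set 'rV[R]_n) : set 'rV[R]_n := [set lambda *: x | x in K].

Definition msum (R : realType) (n : nat) (K L : set 'rV[R]_n)
  : set 'rV[R]_n := [set x + y | x in K & y in L].

(* {x - y : x in K, y in L}, not the erosion often called Minkowski
   difference. *)
Definition mdiff (R : realType) (n : nat) (K L : set 'rV[R]_n)
  : set 'rV[R]_n := [set x - y | x in K & y in L].

Definition convex_body (R : realType) (n : nat) (K : set 'rV[R]_n) : Prop :=
  [/\ K !=set0, compact K & convex_set K].

(* The set A of centres is arbitrary; A = set0 gives setT, which
   convex_body excludes as soon as 0 < n. *)
Definition ball_body (R : realType) (n : nat) (K : set 'rV[R]_n) : Prop :=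
  convex_body K /\
  exists A : set 'rV[R]_n, K = \bigcap_(x in A) translate x (@unit_ball R n).

Definition hausdorff_dist (R : realType) (n : nat) (K L : set 'rV[R]_n) : R :=
  inf [set lambda : R | [/\ 0 < lambda,
    L `<=` msum K (dilate lambda (@unit_ball R n)) &
    K `<=` msum L (dilate lambda (@unit_ball R n))]].

(* Definite description: for K a ball-body there is exactly one ball-body L
   with K - L = unit_ball, namely \bigcap_(x in K) translate x unit_ball. The
   default set0 is only used when there is no such L. *)
Definition cdual (R : realType) (n : nat) (K : set 'rV[R]_n)
  : set 'rV[R]_n :=
  xget set0 [set L : set 'rV[R]_n | ball_body L /\ mdiff K L = @unit_ball R n].

(* Vectors are rows, so the orthogonal matrix Q acts on the right. *)
Definition rigid_motion (R : realType) (n : nat)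
  (g : 'rV[R]_n -> 'rV[R]_n) : Prop :=
  exists (Q : 'M[R]_n) (a : 'rV[R]_n),
    Q *m Q^T = 1%:M /\ forall x, g x = x *m Q + a.

(* Main.v *)
(* For points x, y one has d({x},{y}) = d(x+B,y+B) = |x-y| and
   d({x},y+B) = |x-y| + 1.  Let y be at distance D from x and let A, B, A', B'
   be the images of {x}, x+B, {y}, y+B.  Directions realising
   d(A,B') = d(B,A') = D + 1 become parallel as D grows, and since
   d(A,A') = d(B,B') = D, in these directions one of A, B exceeds the other by
   1 on both sides.  As widths of ball-bodies are at most 2, one of A, B has
   width 0, hence is a point by the spindle property, and the other has
   diameter 2, hence is a unit ball; d(A,B) = 1 makes them concentric.
   So T maps points to points f(x), or all points to balls and all unit balls
   to points, where f is an isometry of R^n.  Finally K is the intersection of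
   the unit balls x+B containing it, and K is contained in x+B iff
   d({x},K) <= 1, while x is in K iff d(x+B,K) <= 1; so TK is determined by
   f, as f(K) in the first case and f(K^c) in the second. *)

Require Import Defs.
From mathcomp Require Import all_boot all_order all_algebra.
From mathcomp Require Import all_classical all_reals all_analysis.
From mathcomp Require Import ring lra.

Set Implicit Arguments.
Unset Strict Implicit.
Unset Printing Implicit Defensive.

Import Order.TTheory GRing.Theory Num.Theory.
Import numFieldNormedType.Exports.

Local Open Scope classical_set_scope.
Local Open Scope ring_scope.

(** * The Euclidean inner product and its norm *)

Definition dot {R : realType} {n : nat} (x y : 'rV[R]_n) : R :=
  \sum_(i < n) x ord0 i * y ord0 i.

Section Euclidean.
Context {R : realType} {n : nat}.
Implicit Types (x y z u v w : 'rV[R]_n) (a r : R).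

Lemma dotC x y : dot x y = dot y x.
Proof. by apply: eq_bigr => i _; rewrite mulrC. Qed.

Lemma dotDl x y z : dot (x + y) z = dot x z + dot y z.
Proof. by rewrite -big_split; apply: eq_bigr => i _ /=; rewrite mxE mulrDl. Qed.

Lemma dotZl a x y : dot (a *: x) y = a * dot x y.
Proof. by rewrite mulr_sumr; apply: eq_bigr => i _; rewrite mxE mulrA. Qed.

Lemma dotNl x y : dot (- x) y = - dot x y.
Proof. by rewrite -scaleN1r dotZl mulN1r. Qed.

Lemma dot0l x : dot 0 x = 0.
Proof. by rewrite -(scale0r 0) dotZl mul0r. Qed.

Lemma dotDr x y z : dot z (x + y) = dot z x + dot z y.
Proof. by rewrite !(dotC z) dotDl. Qed.

Lemma dotZr a x y : dot y (a *: x) = a * dot y x.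
Proof. by rewrite !(dotC y) dotZl. Qed.

Lemma dotNr x y : dot y (- x) = - dot y x.
Proof. by rewrite !(dotC y) dotNl. Qed.

Definition dotE := (dotDl, dotDr, dotNl, dotNr, dotZl, dotZr).

Lemma dot_ge0 x : 0 <= dot x x.
Proof. by apply: sumr_ge0 => i _; rewrite -expr2 sqr_ge0. Qed.

Lemma enormE x : enorm x = Num.sqrt (dot x x).
Proof. by congr Num.sqrt; apply: eq_bigr => i _; rewrite expr2. Qed.

Lemma enorm_ge0 x : 0 <= enorm x.
Proof. exact: sqrtr_ge0. Qed.

Lemma sqr_enorm x : enorm x ^+ 2 = dot x x.
Proof. by rewrite enormE sqr_sqrtr // dot_ge0. Qed.

Lemma enorm_le x r : 0 <= r -> (enorm x <= r) = (dot x x <= r ^+ 2).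
Proof. by move=> r0; rewrite -sqr_enorm ler_sqr // nnegrE enorm_ge0. Qed.

Lemma dot_eq0 x : dot x x = 0 -> x = 0.
Proof.
move=> /eqP; rewrite psumr_eq0; last by move=> i _; rewrite -expr2 sqr_ge0.
move=> /allP h; apply/rowP => i; rewrite mxE.
by have := h i (mem_index_enum i); rewrite -expr2 sqrf_eq0 => /eqP.
Qed.

Lemma enorm_eq0 x : enorm x = 0 -> x = 0.
Proof. by move=> h; apply: dot_eq0; rewrite -sqr_enorm h expr0n. Qed.

Lemma enorm0 : enorm (0 : 'rV[R]_n) = 0.
Proof. by rewrite enormE dot0l sqrtr0. Qed.

Lemma enormZ a x : enorm (a *: x) = `|a| * enorm x.
Proof.
by rewrite !enormE dotZl dotZr mulrA -expr2 sqrtrM ?sqr_ge0 // sqrtr_sqr.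
Qed.

Lemma enormN x : enorm (- x) = enorm x.
Proof. by rewrite -scaleN1r enormZ normrN1 mul1r. Qed.

Lemma enormB x y : enorm (x - y) = enorm (y - x).
Proof. by rewrite -enormN opprB. Qed.

(** Cauchy-Schwarz, from expanding the square of [enorm y *: x - enorm x *: y]. *)
Lemma dot_le x y : dot x y <= enorm x * enorm y.
Proof.
have [x0|xn] := eqVneq (enorm x) 0.
  by rewrite x0 mul0r (enorm_eq0 x0) dot0l.
have [y0|yn] := eqVneq (enorm y) 0.
  by rewrite y0 mulr0 (enorm_eq0 y0) dotC dot0l.
have xp : 0 < enorm x by rewrite lt_neqAle eq_sym xn enorm_ge0.
have yp : 0 < enorm y by rewrite lt_neqAle eq_sym yn enorm_ge0.
have := dot_ge0 (enorm y *: x - enorm x *: y).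
rewrite !dotE -!sqr_enorm (dotC y x).
set a := enorm x; set b := enorm y; set d := dot x y => h.
have : 0 <= (a * b) * (a * b - d) by nra.
by rewrite pmulr_rge0 ?subr_ge0 // mulr_gt0.
Qed.

Lemma dot_unit_le x u : enorm u = 1 -> dot x u <= enorm x.
Proof. by move=> u1; have := dot_le x u; rewrite u1 mulr1. Qed.

Lemma dot_unit u : enorm u = 1 -> dot u u = 1.
Proof. by move=> u1; rewrite -sqr_enorm u1 expr1n. Qed.

Lemma enormD x y : enorm (x + y) <= enorm x + enorm y.
Proof.
rewrite enorm_le ?addr_ge0 ?enorm_ge0 // !dotE (dotC y x) -!sqr_enorm.
have := dot_le x y; nra.
Qed.

Lemma enorm_triangle y x z : enorm (x - z) <= enorm (x - y) + enorm (y - z).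
Proof.
rewrite (_ : x - z = (x - y) + (y - z)) ?enormD //.
by rewrite addrA subrK.
Qed.

Lemma unit_exists : (1 <= n)%N -> exists u : 'rV[R]_n, enorm u = 1.
Proof.
move=> n_ge1; exists (delta_mx 0 (Ordinal n_ge1)).
rewrite enormE /dot (bigD1 (Ordinal n_ge1)) //= big1.
  by rewrite !mxE !eqxx mulr1 addr0 sqrtr1.
by move=> i /negbTE ni; rewrite !mxE ni andbF mulr0.
Qed.

(** For [x = 0] any unit vector serves, so later arguments can take the direction of a vector
    without a case split. *)
Lemma norming (n_ge1 : (1 <= n)%N) x :
  exists u : 'rV[R]_n, enorm u = 1 /\ x = enorm x *: u.
Proof.
have [x0|xn] := eqVneq (enorm x) 0.
  have [u u1] := unit_exists n_ge1; exists u; split=> //.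
  by rewrite x0 scale0r; exact: enorm_eq0.
exists ((enorm x)^-1 *: x); split; last by rewrite scalerA divff // scale1r.
by rewrite enormZ ger0_norm ?invr_ge0 ?enorm_ge0 // mulVf.
Qed.

Lemma dot_continuous u : continuous (fun x => dot x u).
Proof.
move=> x; apply: (cvg_big _ (F := nbhs x)); first exact: add_continuous.
by move=> i _; apply: cvgMl; exact: coord_continuous.
Qed.

Lemma sqdist_continuous y : continuous (fun x => dot (x - y) (x - y)).
Proof.
move=> x; apply: (cvg_big _ (F := nbhs x)); first exact: add_continuous.
move=> i _.
have h : (fun z : 'rV[R]_n => (z - y) ord0 i) @ x --> (x - y) ord0 i.
  rewrite (_ : (fun z : 'rV[R]_n => (z - y) ord0 i) =
    (fun z => z ord0 i - y ord0 i)); last by apply/funext => z; rewrite !mxE.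
  rewrite !mxE; apply: (cvgB (F := nbhs x)); last exact: cvg_cst.
  exact: coord_continuous.
exact: (cvgM h h).
Qed.

End Euclidean.

(** * Ball-bodies: containing unit balls, spindles, separation *)

Notation uball c := (translate c (@unit_ball _ _)).

Section BallBodies.
Context {R : realType} {n : nat}.
Implicit Types (x y z u v w c : 'rV[R]_n) (a r : R) (K L : set 'rV[R]_n).

Lemma uballE c y : uball c y <-> enorm (y - c) <= 1.
Proof.
split=> [[z /= z1 <-]|yc]; first by rewrite addrC addKr.
by exists (y - c) => //; rewrite addrC subrK.
Qed.

(** Enlarging the family of centres to all unit balls that contain [K] does not change the
    intersection, and it removes the arbitrary choice of [A]. *)
Lemma ball_bodyE K : ball_body K ->
  forall y, K y <-> forall c, K `<=` uball c -> enorm (y - c) <= 1.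
Proof.
move=> [_ [A KA]] y; split=> [Ky c Kc|h]; first by apply/uballE/Kc.
rewrite KA => c Ac; apply/uballE/h => z; rewrite KA; exact.
Qed.

Lemma sup_norm_le_enorm x : `|x| <= enorm x.
Proof.
rewrite (_ : `|x| = mx_norm x) // mx_normrE; apply/bigmax_leP; split=> [|[i j] _ /=].
  exact: enorm_ge0.
rewrite -(ler_sqr (normr_ge0 _) (enorm_ge0 x)) // sqr_enorm real_normK ?num_real //.
rewrite /dot (bigD1 j) //= (ord1 i) expr2 lerDl.
by apply: sumr_ge0 => k _; rewrite -expr2 sqr_ge0.
Qed.

Lemma setT_not_compact : (1 <= n)%N -> ~ compact [set: 'rV[R]_n].
Proof.
move=> /(@unit_exists R n)[u u1] /compact_bounded [M [Mreal hM]].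
have u0 : `|u| != 0.
  rewrite normr_eq0; apply: contra_eqN u1 => /eqP ->.
  by rewrite enorm0 eq_sym oner_eq0.
have /= := hM (`|M| + 1) _ (((`|M| + 2) / `|u|) *: u) I.
rewrite normrZ normrM normfV normr_id divfK // ger0_norm ?addr_ge0 // lerD2l.
move=> h; have : (2 : R) <= 1 by apply: h; rewrite (le_lt_trans (ler_norm M)) // ltrDl.
by rewrite leNgt ltr1n.
Qed.

(** An empty family of centres would give the whole space, which is not compact. *)
Lemma ball_body_center (n_ge1 : (1 <= n)%N) K :
  ball_body K -> exists c, K `<=` uball c.
Proof.
move=> [[_ cK _] [A KA]].
have [A0|/set0P[c Ac]] := eqVneq A set0; last by exists c; rewrite KA => y; exact.
by exfalso; apply: (setT_not_compact n_ge1); move: cK; rewrite KA A0 bigcap_set0.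
Qed.

Lemma ball_body_diam (n_ge1 : (1 <= n)%N) K x y :
  ball_body K -> K x -> K y -> enorm (x - y) <= 2.
Proof.
move=> /(ball_body_center n_ge1)[c Kc] /Kc/uballE xc /Kc/uballE yc.
apply: le_trans (enorm_triangle c _ _) _.
by rewrite (enormB c) (_ : 2 = 1 + 1) ?lerD //; ring.
Qed.

(* A ball-body containing x and y contains all circular arcs of radius 1
   joining them, which bulge quadratically off the segment. *)
Lemma spindle K x y t w : ball_body K -> K x -> K y -> 0 <= t <= 1 ->
  enorm w <= 1 ->
  K (x + t *: (y - x) + (t * (1 - t) / 2 * dot (y - x) (y - x)) *: w).
Proof.
move=> bK Kx Ky /andP[t0 t1] w1; apply/(ball_bodyE bK) => c Kc.
have /uballE xc := Kc _ Kx; have /uballE yc := Kc _ Ky.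
set s := _ * dot _ _.
have s0 : 0 <= s by rewrite !mulr_ge0 ?dot_ge0 ?subr_ge0.
pose m := x - c + t *: (y - x).
rewrite (_ : _ - c = m + s *: w); last by apply/rowP => i; rewrite !mxE; ring.
(* By construction [2 * s] is the defect [t * (1 - t) * dot (y - x) (y - x)] in the convexity of the
   squared norm. Hence [enorm m ^+ 2 <= 1 - 2 * s], and [(enorm m - 1) ^+ 2 >= 0] turns this into
   [enorm m + s <= 1]. *)
have me : enorm m ^+ 2 = (1 - t) * enorm (x - c) ^+ 2 +
    t * enorm (y - c) ^+ 2 - 2 * s.
  rewrite (_ : y - c = (x - c) + (y - x)); last first.
    by apply/rowP => i; rewrite !mxE; ring.
  rewrite !sqr_enorm /m /s !dotE !(dotC c) !(dotC y x); by field.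
have sw : enorm (s *: w) <= s by rewrite enormZ ger0_norm // ler_piMr.
apply: le_trans (enormD _ _) _.
have := enorm_ge0 m; have := enorm_ge0 (x - c); have := enorm_ge0 (y - c).
move: me xc yc sw; set e := enorm m; set p := enorm (x - c); set q := enorm (y - c).
move=> me p1 q1 sw q0 p0 e0.
have pp : p ^+ 2 <= 1 by rewrite expr_le1.
have qq : q ^+ 2 <= 1 by rewrite expr_le1.
have : (1 - t) * p ^+ 2 + t * q ^+ 2 <= 1.
  have : (1 - t) * p ^+ 2 <= (1 - t) * 1 by rewrite ler_wpM2l // subr_ge0.
  have : t * q ^+ 2 <= t * 1 by rewrite ler_wpM2l.
  lra.
have : 0 <= (e - 1) ^+ 2 by rewrite sqr_ge0.
rewrite sqrrB; lra.
Qed.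

Lemma ball_body_segment K x y t : ball_body K -> K x -> K y -> 0 <= t <= 1 ->
  K (x + t *: (y - x)).
Proof.
move=> bK Kx Ky t01; have := spindle bK Kx Ky t01 (w := 0).
by rewrite scaler0 addr0 enorm0; apply.
Qed.

Lemma closed_uball c : closed (uball c).
Proof.
rewrite (_ : uball c = (fun x => dot (x - c) (x - c)) @^-1` [set r | r <= 1]).
  apply: preimage_closed (@closed_le R 1) => x _; exact: sqdist_continuous.
apply/seteqP; split=> y.
  by move=> /uballE; rewrite enorm_le // expr1n.
by move=> /= h; apply/uballE; rewrite enorm_le // expr1n.
Qed.

Lemma compact_uball c : compact (uball c).
Proof.
apply: bounded_closed_compact; last exact: closed_uball.
exists (1 + enorm c); split; first exact: num_real.
move=> M cM y /uballE yc; apply: le_trans (sup_norm_le_enorm y) _.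
rewrite -(subrK c y); apply: le_trans (enormD _ _) _.
by apply: le_trans (ltW cM); rewrite lerD2r.
Qed.

Lemma ball_bodyI (A : set 'rV[R]_n) c : A c ->
  \bigcap_(x in A) uball x !=set0 -> ball_body (\bigcap_(x in A) uball x).
Proof.
move=> Ac A0; split; last by exists A.
split=> //.
  apply: (subclosed_compact _ (@compact_uball c)); last by move=> y; exact.
  by apply: closed_bigI => x _; exact: closed_uball.
move=> x y l; rewrite !inE => hx hy z Az; apply/uballE.
have /uballE xz := hx _ Az; have /uballE yz := hy _ Az.
have l0 : 0 <= l%:num by [].
have l1 : 0 <= 1 - l%:num by rewrite subr_ge0.
rewrite (_ : _ - z = l%:num *: (x - z) + (1 - l%:num) *: (y - z)); last first.
  by apply/rowP => i; rewrite !mxE /unstable.onem; ring.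
apply: le_trans (enormD _ _) _; rewrite !enormZ !ger0_norm //.
have := ler_wpM2l l0 xz; have := ler_wpM2l l1 yz; lra.
Qed.

Lemma ball_body_uball c : ball_body (uball c).
Proof.
rewrite (_ : uball c = \bigcap_(x in [set c]) uball x); last by rewrite bigcap_set1.
apply: (@ball_bodyI _ c) => //; rewrite bigcap_set1; exists c.
by apply/uballE; rewrite subrr enorm0.
Qed.

(** A point [y] other than [c] is cut off by the unit ball with centre [c - u], where [u] is the
    direction from [c] to [y]: its distance to that centre is [enorm (y - c) + 1]. *)
Lemma ball_body_set1 (n_ge1 : (1 <= n)%N) c : ball_body [set c].
Proof.
have E : [set c] = \bigcap_(x in uball c) uball x.
  apply/seteqP; split=> [_ -> x /uballE xc|y hy].
    by apply/uballE; rewrite enormB.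
  have [u [u1 yu]] := norming n_ge1 (y - c).
  have /hy/uballE : uball c (c - u) by apply/uballE; rewrite addrC addKr enormN u1.
  rewrite (_ : _ - _ = (y - c) + u); last first.
    by apply/rowP => i; rewrite !mxE; ring.
  rewrite [in X in enorm X]yu -[X in _ *: _ + X]scale1r -scalerDl enormZ u1 mulr1.
  rewrite ger0_norm ?addr_ge0 ?enorm_ge0 // gerDr => h.
  have /eqP : enorm (y - c) = 0 by apply/eqP; rewrite eq_le h enorm_ge0.
  by move=> /eqP/enorm_eq0/eqP; rewrite subr_eq0 => /eqP.
rewrite E; apply: (@ball_bodyI _ c); first by apply/uballE; rewrite subrr enorm0.
by rewrite -E; exists c.
Qed.

(** The limit [t -> 0] in algebraic form: if [s > 0], then [t = s / (s + q)] gives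
    [s * (s + q) <= s * q]. It extracts first-order conditions at extremal points. *)
Lemma le0_of_scaled (s q : R) :
  0 <= q -> (forall t, 0 < t -> t <= 1 -> s <= t * q) -> s <= 0.
Proof.
move=> q0 h; rewrite leNgt; apply/negP => s0.
have sq : 0 < s + q by rewrite ltr_pwDl.
have := h (s / (s + q)); rewrite divr_gt0 // ler_pdivrMr // mul1r lerDl.
move=> /(_ isT q0); rewrite mulrAC ler_pdivlMr //; nra.
Qed.

(** The vector [u] points from the nearest point [k0] of [K] to [l]; minimality along the segments
    from [k0] puts [K] behind the hyperplane through [k0] orthogonal to [u]. *)
Lemma ball_body_separation K l r : ball_body K -> 0 <= r ->
  (forall k, K k -> r < enorm (l - k)) ->
  exists u, enorm u = 1 /\ forall k, K k -> r <= dot (l - k) u.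
Proof.
move=> bK r0 far; have [[K0 cK _] _] := bK.
have [k0] := EVT_min_rV K0 cK (continuous_subspaceT (@sqdist_continuous R n l)).
rewrite inE => Kk0 min.
set d := enorm (l - k0); have rd : r < d by exact: far.
have d0 : 0 < d by exact: le_lt_trans rd.
exists (d^-1 *: (l - k0)); split.
  by rewrite enormZ ger0_norm ?invr_ge0 ?(ltW d0) // mulVf // gt_eqF.
move=> k Kk; rewrite dotZr mulrC ler_pdivlMr //.
suff h : dot (k - k0) (l - k0) <= 0.
  rewrite (_ : l - k = (l - k0) - (k - k0)); last first.
    by apply/rowP => i; rewrite !mxE; ring.
  rewrite dotDl dotNl -sqr_enorm -/d expr2.
  have : r * d <= d * d by rewrite ler_pM2r // ltW.
  lra.
set p := dot (k - k0) (l - k0); set q := dot (k - k0) (k - k0).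
have E (a b : 'rV[R]_n) s :
    dot (s *: a - b) (s *: a - b) = s * (s * dot a a - 2 * dot a b) + dot b b.
  by rewrite !dotE (dotC b a); ring.
(* Moving from [k0] by [t *: (k - k0)] changes the squared distance to [l] by [t * (t * q - 2 * p)],
   which cannot be negative. *)
have key t : 0 < t -> t <= 1 -> 2 * p <= t * q.
  move=> t0 t1; have : K (k0 + t *: (k - k0)).
    by apply: ball_body_segment => //; rewrite (ltW t0).
  move=> /mem_set/min.
  rewrite (_ : k0 + t *: (k - k0) - l = t *: (k - k0) - (l - k0)); last first.
    by apply/rowP => i; rewrite !mxE; ring.
  rewrite -(opprB l k0) dotNl dotNr opprK E -/p -/q => h.
  rewrite -(ler_pM2l t0); lra.
have q0 : 0 <= q by exact: dot_ge0.
have : 2 * p <= 0 by exact: le0_of_scaled q0 key.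
lra.
Qed.

End BallBodies.

(** * The Hausdorff distance through pointwise one-sided coverings, and its values on points and
    unit balls *)

Definition rcover {R : realType} {n : nat} (r : R) (K L : set 'rV[R]_n) : Prop :=
  forall l, L l -> exists2 k, K k & enorm (l - k) <= r.

Section Hausdorff.
Context {R : realType} {n : nat}.
Implicit Types (x y z u v w c : 'rV[R]_n) (a r s : R) (K L : set 'rV[R]_n).

(* Unqualified, [msum] is the sum of measures of MathComp-Analysis. *)
Lemma rcoverE K L r : 0 < r ->
  L `<=` Defs.msum K (dilate r (@unit_ball R n)) <-> rcover r K L.
Proof.
move=> r0; split=> h l /h.
  move=> [k Kk [_ [b b1 <-] <-]]; exists k => //.
  by rewrite addrC addKr enormZ gtr0_norm // ger_pMr.
move=> [k Kk lk]; exists k => //; exists (l - k); last by rewrite addrC subrK.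
exists (r^-1 *: (l - k)); last by rewrite scalerA divff ?gt_eqF // scale1r.
by rewrite /unit_ball /= enormZ gtr0_norm ?invr_gt0 // mulrC ler_pdivrMr // mul1r.
Qed.

Lemma rcover_le K L r s : r <= s -> rcover r K L -> rcover s K L.
Proof. by move=> rs h l /h [k Kk /le_trans lk]; exists k => //; exact: lk. Qed.

Lemma hausdorff_distC K L : hausdorff_dist K L = hausdorff_dist L K.
Proof. by congr inf; apply/seteqP; split=> r [? ? ?]; split. Qed.

Lemma hausdorff_dist_le K L r : 0 <= r -> rcover r K L -> rcover r L K ->
  hausdorff_dist K L <= r.
Proof.
move=> r0 KL LK; apply/ler_addgt0Pr => e e0; apply: ge_inf.
  by exists 0 => s [/ltW].
have re : 0 < r + e by rewrite ltr_wpDl.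
have rre : r <= r + e by rewrite lerDl ltW.
by split => //; apply/(rcoverE _ _ re); apply: rcover_le rre _.
Qed.

Lemma rcover_exists (n_ge1 : (1 <= n)%N) K L : ball_body K -> ball_body L ->
  exists r, 0 < r /\ rcover r K L.
Proof.
move=> bK bL; have [c Kc] := ball_body_center n_ge1 bK.
have [d Ld] := ball_body_center n_ge1 bL; have [[[k Kk] _ _] _] := bK.
exists (2 + enorm (c - d)); split; first by rewrite ltr_pwDl // enorm_ge0.
move=> l /Ld/uballE ld; exists k => //; have /uballE kc := Kc _ Kk.
apply: le_trans (enorm_triangle d _ _) _.
have := enorm_triangle c d k; rewrite (enormB d c) (enormB c k); lra.
Qed.

(** Guarantees that [inf] in [hausdorff_dist] is a genuine infimum: ball-bodies are bounded, so a
    common covering radius exists. *)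
Lemma hausdorff_has_inf (n_ge1 : (1 <= n)%N) K L : ball_body K -> ball_body L ->
  has_inf [set r | [/\ 0 < r, L `<=` Defs.msum K (dilate r (@unit_ball R n)) &
    K `<=` Defs.msum L (dilate r (@unit_ball R n))]].
Proof.
move=> bK bL; split; last by exists 0 => s [/ltW].
have [r [r0 rKL]] := rcover_exists n_ge1 bK bL.
have [s [s0 sLK]] := rcover_exists n_ge1 bL bK.
have rs : 0 < r + s by rewrite addr_gt0.
exists (r + s); split=> //; apply/(rcoverE _ _ rs).
  by apply: rcover_le rKL; rewrite lerDl ltW.
by apply: rcover_le sLK; rewrite lerDr ltW.
Qed.

Lemma hausdorff_dist_lt (n_ge1 : (1 <= n)%N) K L r :
  ball_body K -> ball_body L -> hausdorff_dist K L < r ->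
  rcover r K L /\ rcover r L K.
Proof.
move=> bK bL; rewrite -subr_gt0 => d0.
have [s [s0 /(rcoverE _ _ s0) KL /(rcoverE _ _ s0) LK]] :=
  inf_adherent d0 (hausdorff_has_inf n_ge1 bK bL).
by rewrite -/(hausdorff_dist K L) addrC subrK => /ltW sr; split; exact: rcover_le sr _.
Qed.

Lemma hausdorff_dist_ge (n_ge1 : (1 <= n)%N) K L r :
  ball_body K -> ball_body L ->
  (forall s, rcover s K L -> rcover s L K -> r <= s) ->
  r <= hausdorff_dist K L.
Proof.
move=> bK bL h; have [ne _] := hausdorff_has_inf n_ge1 bK bL.
by apply: lb_le_inf ne _ => s [s0 /(rcoverE _ _ s0) + /(rcoverE _ _ s0)]; exact: h.
Qed.

(** A point of [L] that lies ahead of all of [K] by [r] in a unit direction is at distance at least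
    [r] from [K]. *)
Lemma hausdorff_dist_ge_dir (n_ge1 : (1 <= n)%N) K L r : ball_body K -> ball_body L ->
  (exists l u, [/\ L l, enorm u = 1 & forall k, K k -> r <= dot (l - k) u]) ->
  r <= hausdorff_dist K L.
Proof.
move=> bK bL [l [u [Ll u1 h]]]; apply: hausdorff_dist_ge => // s /(_ l Ll)[k Kk lk] _.
by apply: le_trans (h _ Kk) (le_trans (dot_unit_le _ u1) lk).
Qed.

Lemma hausdorff_dist_11 (n_ge1 : (1 <= n)%N) x y :
  hausdorff_dist [set x] [set y] = enorm (x - y).
Proof.
apply/eqP; rewrite eq_le; apply/andP; split.
  apply: hausdorff_dist_le; first exact: enorm_ge0.
    by move=> _ ->; exists x => //; rewrite enormB.
  by move=> _ ->; exists y.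
apply: hausdorff_dist_ge; [by []|exact: ball_body_set1|exact: ball_body_set1|].
by move=> s _ /(_ x erefl) [_ ->].
Qed.

(** The point of the ball farthest from [x] is [y + u], with [u] the direction from [x] to [y]. *)
Lemma hausdorff_dist_1b (n_ge1 : (1 <= n)%N) x y :
  hausdorff_dist [set x] (uball y) = enorm (x - y) + 1.
Proof.
have [u [u1 yx]] := norming n_ge1 (y - x).
have yu : uball y (y + u) by apply/uballE; rewrite addrC addKr u1.
apply/eqP; rewrite eq_le; apply/andP; split.
  apply: hausdorff_dist_le; first by rewrite addr_ge0 ?enorm_ge0.
    move=> z /uballE zy; exists x => //; rewrite [leRHS]addrC.
    by apply: le_trans (enorm_triangle y _ _) _; rewrite (enormB y x) lerD2r.
  move=> _ ->; exists y; last by rewrite lerDl.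
  by apply/uballE; rewrite subrr enorm0.
apply: hausdorff_dist_ge_dir => //; [exact: ball_body_set1|exact: ball_body_uball|].
exists (y + u), u; split=> // _ ->.
rewrite (_ : _ - x = (y - x) + u); last by apply/rowP => i; rewrite !mxE; ring.
by rewrite dotDl yx dotZl (dot_unit u1) mulr1 enormB.
Qed.

(** Translating one ball onto the other gives the upper bound; the point [y + u] farthest ahead
    gives the lower one. *)
Lemma hausdorff_dist_bb (n_ge1 : (1 <= n)%N) x y :
  hausdorff_dist (uball x) (uball y) = enorm (x - y).
Proof.
have [u [u1 yx]] := norming n_ge1 (y - x).
have yu : uball y (y + u) by apply/uballE; rewrite addrC addKr u1.
have tr (a b : 'rV[R]_n) : rcover (enorm (a - b)) (uball a) (uball b).
  move=> z /uballE zb; exists (z + (a - b)).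
    apply/uballE; rewrite (_ : _ - a = z - b) //.
    by apply/rowP => i; rewrite !mxE; ring.
  by rewrite opprD addrA subrr add0r enormN.
apply/eqP; rewrite eq_le; apply/andP; split.
  by apply: hausdorff_dist_le; rewrite ?enorm_ge0 // enormB.
apply: hausdorff_dist_ge_dir => //; try exact: ball_body_uball.
exists (y + u), u; split=> // k /uballE kx.
rewrite (_ : _ - k = (y - x) + u - (k - x)); last first.
  by apply/rowP => i; rewrite !mxE; ring.
rewrite 2!dotDl dotNl yx dotZl (dot_unit u1) mulr1 enormB.
have := dot_unit_le (k - x) u1; lra.
Qed.

Lemma subset_uballP (n_ge1 : (1 <= n)%N) K c : ball_body K ->
  K `<=` uball c <-> hausdorff_dist [set c] K <= 1.
Proof.
move=> bK; have b1 := ball_body_set1 n_ge1 c; split=> [Kc|h k Kk].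
  have [[[k Kk] _ _] _] := bK.
  apply: hausdorff_dist_le => // [l /Kc/uballE lc|_ ->]; first by exists c.
  by exists k => //; rewrite enormB; apply/uballE/Kc.
apply/uballE/ler_addgt0Pr => e e0.
have [|/(_ k Kk)[_ -> ]//] := hausdorff_dist_lt n_ge1 b1 bK (r := 1 + e).
by rewrite (le_lt_trans h) // ltrDl.
Qed.

(** If [c] is in [K], points of [K] are within 2 of [c], hence within 1 of the unit sphere around
    [c]. Conversely, if [K] lies in the ball around [d], the point [c + u] with [u] directed from
    [d] to [c] must be nearly within 1 of [K], which forces [enorm (c - d) <= 1] in the limit. *)
Lemma center_memP (n_ge1 : (1 <= n)%N) K c : ball_body K ->
  K c <-> hausdorff_dist (uball c) K <= 1.
Proof.
move=> bK; have b1 := ball_body_uball c; split=> [Kc|h].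
  apply: hausdorff_dist_le => // [k Kk|z /uballE zc]; last by exists c.
  have [u [u1 ku]] := norming n_ge1 (k - c).
  exists (c + u); first by apply/uballE; rewrite addrC addKr u1.
  rewrite opprD addrA ku -[X in _ - X]scale1r -scalerBl enormZ u1 mulr1.
  have := ball_body_diam n_ge1 bK Kk Kc; have := enorm_ge0 (k - c).
  by rewrite ler_norml => ? ?; apply/andP; split; lra.
apply/(ball_bodyE bK) => d Kd; apply/ler_addgt0Pr => e e0.
have [|_ near] := hausdorff_dist_lt n_ge1 b1 bK (r := 1 + e).
  by rewrite (le_lt_trans h) // ltrDl.
have [u [u1 cu]] := norming n_ge1 (c - d).
have [|k /Kd/uballE kd kcu] := near (c + u); first by apply/uballE; rewrite addrC addKr u1.
have : dot (c - d) u + dot u u <= dot (c + u - k) u + dot (k - d) u.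
  rewrite -!dotDl (_ : c - d + u = c + u - k + (k - d)) //.
  by apply/rowP => i; rewrite !mxE; ring.
rewrite {1}cu dotZl (dot_unit u1) mulr1.
have := dot_unit_le (c + u - k) u1; have := dot_unit_le (k - d) u1; lra.
Qed.

End Hausdorff.

(** * Recognising concentric pairs of a point and a unit ball by far-away companions *)

Section PointsAndBalls.
Context {R : realType} {n : nat} (n_ge1 : (1 <= n)%N).
Implicit Types (x y z u v w a b c d k l : 'rV[R]_n) (r s e D : R) (K L A B : set 'rV[R]_n).

(** In terms of support functions, that of [K] at [u] is at least [r] larger than that of [L]. *)
Definition exceeds u r K L : Prop :=
  exists2 k, K k & forall l, L l -> r <= dot (k - l) u.

(** One of the two coverings with radius [r] must fail; the uncovered point is then separated from
    the other body. *)
Lemma exceeds_of_dist K L r : ball_body K -> ball_body L -> 0 <= r ->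
  r < hausdorff_dist K L ->
  exists2 u, enorm u = 1 & exceeds u r K L \/ exceeds u r L K.
Proof.
move=> bK bL r0 rKL.
have far K' L' : ball_body K' -> ~ rcover r K' L' ->
    exists2 u, enorm u = 1 & exceeds u r L' K'.
  move=> bK' /existsNP[l /not_implyP[Ll h]].
  have [|u [u1 hu]] := ball_body_separation bK' r0 (l := l).
    by move=> k Kk; rewrite ltNge; apply/negP => lk; apply: h; exists k.
  by exists u => //; exists l.
have [KL|nKL] := pselect (rcover r K L); last first.
  by have [u u1 h] := far _ _ bK nKL; exists u => //; right.
have [LK|nLK] := pselect (rcover r L K); last first.
  by have [u u1 h] := far _ _ bL nLK; exists u => //; left.
by move: rKL; rewrite ltNge (hausdorff_dist_le r0 KL LK).
Qed.

(* When A, B are far from A', B', a direction realising d(A,B') = D + 1 is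
   close to that of w, and since passing from A to A' or from B to B' costs
   only D, in that direction one of A, B exceeds the other by almost 1. *)
Lemma far_direction A A' B B' w D e :
  ball_body A -> ball_body A' -> ball_body B -> ball_body B' ->
  0 < e -> e <= 1 -> 0 <= D ->
  hausdorff_dist A B' = D + 1 ->
  hausdorff_dist A A' = D -> hausdorff_dist B B' = D ->
  (forall a b, A a -> B' b -> enorm (b - a - w) <= 6) ->
  exists2 u, enorm u = 1 &
    (exceeds u (1 - 2 * e) B A /\ D - 6 <= dot w u) \/
    (exceeds u (1 - 2 * e) A B /\ D - 6 <= dot w (- u)).
Proof.
move=> bA bA' bB bB' e0 e1 D0 dAB' dAA' dBB' hw.
have [|_ BB'] := hausdorff_dist_lt n_ge1 bB' bB (r := D + e).
  by rewrite hausdorff_distC dBB' ltrDl.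
have [|_ B'B] := hausdorff_dist_lt n_ge1 bB bB' (r := D + e).
  by rewrite dBB' ltrDl.
have [||u u1 [[a Aa h]|[b' B'b' h]]] := exceeds_of_dist bA bB' (r := D + 1 - e).
- lra.
- by rewrite dAB'; lra.
(* Passing from [B'] to [B] loses at most [D + e] of the lead [D + 1 - e], which leaves
   [1 - 2 * e]. *)
- exists u => //; right; split.
    exists a => // b Bb; have [b' B'b' bb'] := B'B _ Bb.
    have := h _ B'b'; rewrite (_ : a - b = (a - b') - (b - b')); last first.
      by apply/rowP => i; rewrite !mxE; ring.
    rewrite (dotDl (a - b')) (dotNl (b - b')); have := dot_unit_le (b - b') u1; lra.
  have [[[b' B'b'] _ _] _] := bB'.
  have := h _ B'b'; have := hw _ _ Aa B'b'.
  have := dot_unit_le (- (b' - a - w)) u1.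
  rewrite enormN (_ : a - b' = (- (b' - a - w)) - w); last first.
    by apply/rowP => i; rewrite !mxE; ring.
  rewrite (dotDl (- _)) (dotNl (b' - a - w)) dotNl dotNr; lra.
- exists u => //; left; split.
    have [b Bb bb'] := BB' _ B'b'; exists b => // a Aa.
    have := h _ Aa; rewrite (_ : b - a = (b' - a) - (b' - b)); last first.
      by apply/rowP => i; rewrite !mxE; ring.
    rewrite (dotDl (b' - a)) (dotNl (b' - b)); have := dot_unit_le (b' - b) u1; lra.
  have [[[a Aa] _ _] _] := bA.
  have := h _ Aa; have := hw _ _ Aa B'b'.
  have := dot_unit_le (b' - a - w) u1.
  rewrite (_ : b' - a = (b' - a - w) + w); last first.
    by apply/rowP => i; rewrite !mxE; ring.
  rewrite (dotDl (b' - a - w)) addrK; lra.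
Qed.

(** Both vectors nearly realise the length of [w], so [u + v] has length close to 2 and [u - v] is
    short. The constant comes from [4 * ((D + 6) ^+ 2 - (D - 6) ^+ 2) = 96 * D]. *)
Lemma near_directions u v w D e : enorm u = 1 -> enorm v = 1 -> 6 < D -> 0 < e ->
  96 <= D * e ^+ 2 -> enorm w <= D + 6 ->
  D - 6 <= dot w u -> D - 6 <= dot w v -> enorm (u - v) <= e.
Proof.
move=> u1 v1 D6 e0 De wD wu wv.
rewrite enorm_le ?(ltW e0) //.
have uu := dot_unit u1; have vv := dot_unit v1.
have : 2 * (D - 6) <= (D + 6) * enorm (u + v).
  have := dot_le w (u + v); rewrite dotDr.
  have : enorm w * enorm (u + v) <= (D + 6) * enorm (u + v).
    by rewrite ler_wpM2r ?enorm_ge0.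
  lra.
have := enorm_ge0 (u + v); have := sqr_enorm (u + v).
rewrite !dotE uu vv (dotC v u); set s := enorm (u + v); set d := dot u v.
move=> ss s0 Ds.
have : (2 * (D - 6)) ^+ 2 <= ((D + 6) * s) ^+ 2.
  by rewrite ler_sqr // nnegrE ?mulr_ge0 //; lra.
rewrite [in X in _ <= X -> _]exprMn ss => Dd.
have d1 : d <= 1 by have := dot_le u v; rewrite u1 v1 mul1r.
have : D ^+ 2 * (2 - 2 * d) <= 96 * D.
  have : 0 <= (1 - d) * (12 * D + 36) by apply: mulr_ge0; lra.
  nra.
have D0 : 0 < D by lra.
rewrite expr2 -mulrA (mulrC 96) ler_pM2l // => h.
have : D * (2 - 2 * d) <= D * e ^+ 2 by exact: le_trans h De.
rewrite ler_pM2l //; lra.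
Qed.

(** Approximate versions of being a point (diameter 0) and a unit ball (the maximal diameter 2),
    with the constants that [narrow_wide] yields. *)
Definition narrow e K := forall x y, K x -> K y -> dot (x - y) (x - y) <= 32 * e.
Definition wide e K := exists x y, [/\ K x, K y & 2 - 8 * e <= enorm (x - y)].

(** Exceeding [A] on two nearly opposite sides makes [B] wider than [A] along [u] by [2 - 8 * e]. As
    [B] has diameter at most 2, it is wide and [A] has width at most [8 * e] along [u]. *)
Lemma narrow_wide A B u v e : ball_body A -> ball_body B ->
  enorm u = 1 -> enorm v = 1 -> 0 < e ->
  (forall a b, A a -> B b -> enorm (b - a) <= 4) ->
  exceeds u (1 - 2 * e) B A -> exceeds v (1 - 2 * e) B A ->
  enorm (u + v) <= e -> narrow e A /\ wide e B.
Proof.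
move=> bA bB u1 v1 e0 hAB [b1 Bb1 h1] [b2 Bb2 h2] uv.
have slack a b : A a -> B b -> `|dot (b - a) (u + v)| <= 4 * e.
  move=> Aa Bb.
  have le4 x : enorm x <= 4 -> dot x (u + v) <= 4 * e.
    move=> x4; apply: le_trans (dot_le _ _) _.
    by rewrite ler_pM ?enorm_ge0.
  rewrite ler_norml lerNl -dotNl !le4 ?enormN ?hAB //.
have key x y : A x -> A y -> 2 - 8 * e <= dot (b1 - b2) u + dot (y - x) u.
  move=> Ax Ay; have := h1 _ Ax; have := h2 _ Ay; have := slack _ _ Ay Bb2.
  rewrite ler_norml => /andP[_]; rewrite dotDr.
  rewrite -dotDl (_ : b1 - b2 + (y - x) = (b1 - x) - (b2 - y)); last first.
    by apply/rowP => i; rewrite !mxE; ring.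
  rewrite (dotDl (b1 - x)) (dotNl (b2 - y)); lra.
have [[[a0 Aa0] _ _] _] := bA.
split; last first.
  exists b1, b2; split=> //; have := key _ _ Aa0 Aa0.
  by rewrite subrr dot0l addr0 => /le_trans; apply; exact: dot_unit_le.
move=> x y Ax Ay.
have h12 : 0 <= (2^-1 : R) <= 1 by apply/andP; split; lra.
have wu : enorm u <= 1 by rewrite u1.
have wNu : enorm (- u) <= 1 by rewrite enormN u1.
(* Thin width forces small diameter: the spindle of [x] and [y] contains the midpoint shifted by [q]
   along [u] both ways, with [q] an eighth of the squared distance, so [2 * q <= 8 * e]. *)
have := key _ _ (spindle bA Ax Ay h12 wu) (spindle bA Ax Ay h12 wNu).
have := dot_unit_le (b1 - b2) u1; have := ball_body_diam n_ge1 bB Bb1 Bb2.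
set q := _ * dot _ _.
rewrite (_ : _ - (_ + q *: u) = - (2 * q) *: u); last first.
  by apply/rowP => i; rewrite !mxE; ring.
rewrite dotZl (dot_unit u1) mulr1 -(opprB y x) dotNl dotNr opprK /q; lra.
Qed.

(** Adding the two leads in nearly equal directions gives [2 - 4 * e <= dot (b - a) (u - v) <= 4 *
    e]. *)
Lemma narrow_wide_contra A B u v e : e < 8^-1 ->
  (forall a b, A a -> B b -> enorm (b - a) <= 4) ->
  exceeds u (1 - 2 * e) B A -> exceeds v (1 - 2 * e) A B ->
  enorm (u - v) <= e -> False.
Proof.
move=> e4 hAB [b Bb hb] [a Aa ha] uv.
have := hb _ Aa; have := ha _ Bb.
have := dot_le (b - a) (u - v).
have : enorm (b - a) * enorm (u - v) <= 4 * e by rewrite ler_pM ?enorm_ge0 ?hAB.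
rewrite dotDr dotNr -(opprB b a) dotNl; lra.
Qed.

Lemma far_pair_narrow_wide A A' B B' D e :
  ball_body A -> ball_body A' -> ball_body B -> ball_body B' ->
  0 < e -> e < 8^-1 -> 6 < D -> 96 <= D * e ^+ 2 ->
  hausdorff_dist A B = 1 -> hausdorff_dist A' B' = 1 ->
  hausdorff_dist A A' = D -> hausdorff_dist B B' = D ->
  hausdorff_dist A B' = D + 1 -> hausdorff_dist B A' = D + 1 ->
  (narrow e A /\ wide e B) \/ (narrow e B /\ wide e A).
Proof.
move=> bA bA' bB bB' e0 e4 D6 De dAB dAB' dAA' dBB' dA_B' dB_A'.
have diam := @ball_body_diam R n n_ge1.
have [[[a Aa] _ _] _] := bA; have [[[a' Aa'] _ _] _] := bA'.
pose w := a' - a.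
(* Distance 1 puts a point within 2 of some point of the other body, whose diameter adds 2. One more
   diameter gives the bound 6 below. *)
have near K L : ball_body K -> ball_body L -> hausdorff_dist K L = 1 ->
    forall k l, K k -> L l -> enorm (l - k) <= 4.
  move=> bK bL d1 k l Kk Ll.
  have [|/(_ _ Ll)[k' Kk' lk'] _] := hausdorff_dist_lt n_ge1 bK bL (r := 2).
    by rewrite d1 ltr1n.
  by have := enorm_triangle k' l k; have := diam _ _ _ bK Kk' Kk; lra.
have hAB := near _ _ bA bB dAB; have hAB' := near _ _ bA' bB' dAB'.
have hBA b x : B b -> A x -> enorm (x - b) <= 4 by rewrite enormB => ? ?; exact: hAB.
have wD : enorm w <= D + 6.
  have [|_ /(_ _ Aa)[k Kk ak]] := hausdorff_dist_lt n_ge1 bA bA' (r := D + 1).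
    by rewrite dAA' ltrDl.
  have := enorm_triangle k a' a; have := diam _ _ _ bA' Aa' Kk.
  by rewrite (enormB k a) /w; lra.
have w1 x y : A x -> B' y -> enorm (y - x - w) <= 6.
  move=> Ax By; rewrite (_ : _ - w = (y - a') + (a - x)); last first.
    by apply/rowP => i; rewrite !mxE; ring.
  apply: le_trans (enormD _ _) _.
  by have := hAB' _ _ Aa' By; have := diam _ _ _ bA Aa Ax; lra.
have w2 x y : B x -> A' y -> enorm (y - x - w) <= 6.
  move=> Bx Ay; rewrite (_ : _ - w = (y - a') + (a - x)); last first.
    by apply/rowP => i; rewrite !mxE; ring.
  apply: le_trans (enormD _ _) _.
  by have := diam _ _ _ bA' Ay Aa'; have := hBA _ _ Bx Aa; lra.
have D0 : 0 <= D by lra. have e1 : e <= 1 by lra.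
have [u u1 hu] := far_direction bA bA' bB bB' e0 e1 D0 dA_B' dAA' dBB' w1.
have [v v1 hv] := far_direction bB bB' bA bA' e0 e1 D0 dB_A' dBB' dAA' w2.
have Nu : enorm (- u) = 1 by rewrite enormN.
have Nv : enorm (- v) = 1 by rewrite enormN.
have uv := near_directions _ _ D6 e0 De wD.
(* Up to sign, [u] and [v] are both close to the direction of [w]. The signs decide whether the same
   body leads on two opposite sides, or each leads on the same side, which is impossible. *)
case: hu => -[hu wu]; case: hv => -[hv wv].
- exfalso; exact: narrow_wide_contra e4 hAB hu hv (uv _ _ u1 v1 wu wv).
- left; apply: narrow_wide hu hv _ => //.
  by have := uv _ _ u1 Nv wu wv; rewrite opprK.
- right; apply: narrow_wide hu hv _ => //.
  by have := uv _ _ Nu v1 wu wv; rewrite -opprD enormN.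
- exfalso; apply: narrow_wide_contra e4 hBA hu hv _.
  by have := uv _ _ Nu Nv wu wv; rewrite -opprD enormN.
Qed.

Lemma narrow_set1 K : ball_body K ->
  (forall e, 0 < e -> e < 8^-1 -> narrow e K) -> exists p, K = [set p].
Proof.
move=> [[[p Kp] _ _] _] h; exists p; apply/seteqP; split=> [x Kx|_ ->] //.
apply/eqP; rewrite -subr_eq0; apply/eqP/dot_eq0/eqP.
rewrite eq_le dot_ge0 andbT; apply/ler_addgt0Pr => e e0; rewrite add0r.
(* The first term cancels the constant in [narrow]; the second keeps [d] below [8^-1]. *)
pose d := Num.min (e / 32) (16^-1).
have d0 : 0 < d by rewrite lt_min; apply/andP; split; lra.
have dle : d <= e / 32 by rewrite ge_min lexx.
have dle' : d <= 16^-1 by rewrite ge_min lexx orbT.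
have := h _ d0 _ _ _ Kx Kp; rewrite (_ : d < 8^-1); last by lra.
move=> /(_ isT) /le_trans; apply; lra.
Qed.

(** Two points at distance almost 2 pin the centre of any unit ball containing them near their
    midpoint. So only one unit ball contains [K], and [K] is the intersection of such balls. *)
Lemma wide_uball K : ball_body K ->
  (forall e, 0 < e -> e < 8^-1 -> wide e K) -> exists c, K = uball c.
Proof.
move=> bK h; have [c Kc] := ball_body_center n_ge1 bK; exists c.
suff uniq d : K `<=` uball d -> d = c.
  apply/seteqP; split=> // y /uballE yc.
  by apply/(ball_bodyE bK) => d /uniq ->.
move=> Kd; apply/eqP; rewrite -subr_eq0; apply/eqP/dot_eq0/eqP.
rewrite eq_le dot_ge0 andbT; apply/ler_addgt0Pr => e e0; rewrite add0r.
pose s := Num.min (e / 64) (16^-1).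
have s0 : 0 < s by rewrite lt_min; apply/andP; split; lra.
have sle : s <= e / 64 by rewrite ge_min lexx.
have sle' : s <= 16^-1 by rewrite ge_min lexx orbT.
have [|x [y [Kx Ky xy]]] := h _ s0; first lra.
(* Parallelogram law: the left side is at most [4 - (2 - 8 * s) ^+ 2]. *)
have near z : K `<=` uball z ->
    dot (x - z + (y - z)) (x - z + (y - z)) <= 32 * s.
  move=> Kz; have /uballE := Kz _ Kx; have /uballE := Kz _ Ky.
  rewrite !enorm_le ?ler01 // expr1n.
  have : (2 - 8 * s) ^+ 2 <= dot (x - y) (x - y).
    by rewrite -sqr_enorm ler_sqr // nnegrE ?enorm_ge0 //; lra.
  rewrite (_ : x - y = (x - z) - (y - z)); last first.
    by apply/rowP => i; rewrite !mxE; ring.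
  move: (x - z) (y - z) => p q; rewrite !dotE (dotC q p); nra.
have := near _ Kc; have := near _ Kd.
have := dot_ge0 ((x - c + (y - c)) + (x - d + (y - d))).
rewrite (_ : d - c = 2^-1 *: ((x - c + (y - c)) - (x - d + (y - d)))); last first.
  by apply/rowP => i; rewrite !mxE; field.
move: (x - c + (y - c)) (x - d + (y - d)) => p q.
rewrite !dotE (dotC q p); lra.
Qed.

Lemma narrow_le e s K : e <= s -> narrow e K -> narrow s K.
Proof. by move=> es h x y Kx Ky; apply: le_trans (h _ _ Kx Ky) _; rewrite ler_pM2l. Qed.

Lemma wide_le e s K : e <= s -> wide e K -> wide s K.
Proof.
move=> es [x [y [Kx Ky h]]]; exists x, y; split=> //; apply: le_trans h.
by rewrite lerD2l lerN2 ler_pM2l.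
Qed.

Lemma point_ball_pair A B : ball_body A -> ball_body B -> hausdorff_dist A B = 1 ->
  (forall e, 0 < e -> e < 8^-1 -> narrow e A /\ wide e B) ->
  exists p, A = [set p] /\ B = uball p.
Proof.
move=> bA bB d1 h.
have [p Ap] := narrow_set1 bA (fun e pos small => proj1 (h e pos small)).
have [c Bc] := wide_uball bB (fun e pos small => proj2 (h e pos small)).
exists p; split=> //; move: d1; rewrite Ap Bc hausdorff_dist_1b //.
rewrite -[RHS]add0r => /addIr/enorm_eq0/eqP.
by rewrite subr_eq0 => /eqP ->.
Qed.

(** Which body is narrow might depend on [e]. Since [narrow] and [wide] are monotone in [e],
    failures of the two alternatives at [e] and [s] would contradict the dichotomy at
    [Num.min e s]. *)
Lemma far_pair_point_ball A B : ball_body A -> ball_body B ->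
  hausdorff_dist A B = 1 ->
  (forall D, 0 < D -> exists A' B', [/\ ball_body A', ball_body B' &
    [/\ hausdorff_dist A' B' = 1, hausdorff_dist A A' = D,
     hausdorff_dist B B' = D, hausdorff_dist A B' = D + 1 &
     hausdorff_dist B A' = D + 1]]) ->
  exists p, (A = [set p] /\ B = uball p) \/ (A = uball p /\ B = [set p]).
Proof.
move=> bA bB d1 far.
have alt e : 0 < e -> e < 8^-1 ->
    (narrow e A /\ wide e B) \/ (narrow e B /\ wide e A).
  move=> e0 e4; have e20 : 0 < e ^+ 2 by rewrite exprn_gt0.
  have De0 : 0 < 96 / e ^+ 2 by rewrite divr_gt0.
  (* This distance satisfies both [6 < D] and [96 <= D * e ^+ 2]. *)
  have [|A' [B' [bA' bB' [? ? ? ? ?]]]] := far (96 / e ^+ 2 + 7).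
    by rewrite addr_gt0.
  apply: (@far_pair_narrow_wide A A' B B' (96 / e ^+ 2 + 7)) => //.
    by rewrite -[ltLHS]add0r ltrD // ltr_nat.
  by rewrite mulrDl divfK ?gt_eqF // lerDl mulr_ge0 // ltW.
have [AB|nAB] := pselect (forall e, 0 < e -> e < 8^-1 -> narrow e A /\ wide e B).
  by have [p h] := point_ball_pair bA bB d1 AB; exists p; left.
have [BA|nBA] := pselect (forall e, 0 < e -> e < 8^-1 -> narrow e B /\ wide e A).
  rewrite hausdorff_distC in d1.
  by have [p [h1 h2]] := point_ball_pair bB bA d1 BA; exists p; right.
exfalso.
move/existsNP: nAB => [e /not_implyP[e0 /not_implyP[e4 nAB]]].
move/existsNP: nBA => [s /not_implyP[s0 /not_implyP[s4 nBA]]].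
have es_e : Num.min e s <= e by rewrite ge_min lexx.
have es_s : Num.min e s <= s by rewrite ge_min lexx orbT.
case: (alt (Num.min e s)); rewrite ?lt_min ?e0 //.
- by rewrite gt_min e4.
- by move=> [/(narrow_le es_e) ? /(wide_le es_e) ?]; apply: nAB.
- by move=> [/(narrow_le es_s) ? /(wide_le es_s) ?]; apply: nBA.
Qed.

End PointsAndBalls.

(** * The c-dual as an intersection of unit balls *)

Section Duality.
Context {R : realType} {n : nat} (n_ge1 : (1 <= n)%N).
Implicit Types (x y z u v w a b c d k l : 'rV[R]_n) (K L : set 'rV[R]_n).

(** At a maximiser [x] of [dot _ u], no spindle from [x] to [y] bulges past [x]. To first order in
    [t] this reads [2 * p + q <= 0], which is membership of [y] in the ball around [x - u]. *)
Lemma supporting_uball K u : ball_body K -> enorm u = 1 ->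
  exists2 x, K x & K `<=` uball (x - u).
Proof.
move=> bK u1; have [[K0 cK _] _] := bK.
have [x] := EVT_max_rV K0 cK (continuous_subspaceT (@dot_continuous R n u)).
rewrite inE => Kx max; exists x => // y Ky; apply/uballE.
rewrite enorm_le ?ler01 // expr1n.
set p := dot (y - x) u; set q := dot (y - x) (y - x).
have key t : 0 < t -> t <= 1 -> 2 * p + q <= t * q.
  move=> t0 t1; have t01 : 0 <= t <= 1 by rewrite (ltW t0).
  have := spindle bK Kx Ky t01 (w := u); rewrite u1 lexx => /(_ isT)/mem_set/max.
  rewrite 2!dotDl 2!dotZl (dot_unit u1) -/p -/q => h.
  have : t * (2 * p + q - t * q) <= 0 by lra.
  by rewrite pmulr_rle0 // subr_le0.
have := le0_of_scaled (dot_ge0 _) key.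
rewrite (_ : y - (x - u) = (y - x) + u); last first.
  by apply/rowP => i; rewrite !mxE; ring.
by rewrite dotDl (dotDr (y - x)) (dotDr (y - x) u u) (dotC u) (dot_unit u1) -/p -/q; lra.
Qed.

Lemma bigcap_uballP K c : K `<=` uball c <-> (\bigcap_(x in K) uball x) c.
Proof. by split=> h x /h /uballE xc; apply/uballE; rewrite enormB. Qed.

Lemma ball_body_bigcap K : ball_body K -> ball_body (\bigcap_(x in K) uball x).
Proof.
move=> bK; have [[[x Kx] _ _] _] := bK.
have [c /bigcap_uballP Kc] := ball_body_center n_ge1 bK.
by apply: ball_bodyI Kx _; exists c.
Qed.

Lemma mdiff_bigcap K : ball_body K ->
  mdiff K (\bigcap_(x in K) uball x) = @unit_ball R n.
Proof.
move=> bK; apply/seteqP; split=> [_ [x Kx [y Dy <-]]|b b1].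
  by rewrite /unit_ball /= enormB; apply/uballE/Dy.
have [u [u1 bu]] := norming n_ge1 b.
have [x Kx /bigcap_uballP Dx] := supporting_uball bK u1.
have Nu1 : enorm (- u) = 1 by rewrite enormN.
have [y Ky /bigcap_uballP Dy] := supporting_uball bK Nu1.
(* The supporting balls realise the differences [u] and [- u]; with this [t], interpolation gives
   [(2 * t - 1) *: u = b]. *)
pose t := (1 + enorm b) / 2.
have t01 : 0 <= t <= 1.
  have := enorm_ge0 b; have : enorm b <= 1 by [].
  by rewrite /t => ? ?; apply/andP; split; lra.
exists (y + t *: (x - y)); first exact: ball_body_segment.
exists (y - - u + t *: (x - u - (y - - u))).
  by apply: ball_body_segment => //; exact: ball_body_bigcap.
by rewrite [RHS]bu; apply/rowP => i; rewrite /t !mxE; field.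
Qed.

(** For [z] in the intersection and a ball around [a] containing [L], write [- w = x - l] with [w]
    the direction from [a] to [z]. Along [w], the terms of [(z - x) + (x - l) + (l - a)] contribute
    at most [1 - 1 + 1]. *)
Lemma mdiff_uball_unique K L : ball_body L -> mdiff K L = @unit_ball R n ->
  L = \bigcap_(x in K) uball x.
Proof.
move=> bL KL; have KL1 x l : K x -> L l -> enorm (x - l) <= 1.
  move=> Kx Ll; have : mdiff K L (x - l) by exists x => //; exists l.
  by rewrite KL.
apply/seteqP; split=> [l Ll x Kx|z Dz].
  by apply/uballE; rewrite enormB; exact: KL1.
apply/(ball_bodyE bL) => a La.
have [w [w1 zw]] := norming n_ge1 (z - a).
have : mdiff K L (- w) by rewrite KL /unit_ball /= enormN w1.
move=> [x Kx [l Ll xl]].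
have /uballE zx := Dz _ Kx; have /uballE la := La _ Ll.
have := dot_unit_le (z - x) w1; have := dot_unit_le (l - a) w1.
have : dot (z - a) w = enorm (z - a) by rewrite {1}zw dotZl dot_unit // mulr1.
rewrite (_ : z - a = (z - x) + (x - l) + (l - a)); last first.
  by apply/rowP => i; rewrite !mxE; ring.
rewrite (dotDl (z - x + (x - l))) (dotDl (z - x)) xl dotNl dot_unit //; lra.
Qed.

Lemma cdualE K : ball_body K -> cdual K = \bigcap_(x in K) uball x.
Proof.
move=> bK; apply: xget_unique.
  by split; [exact: ball_body_bigcap|exact: mdiff_bigcap].
by move=> L [bL KL]; exact: mdiff_uball_unique.
Qed.

End Duality.

(** * Distance-preserving maps of Euclidean space *)

Section RigidMotions.
Context {R : realType} {n : nat}.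
Implicit Types (x y : 'rV[R]_n).

Lemma dotmxE x y : dot x y = (x *m y^T) ord0 ord0.
Proof. by rewrite mxE; apply: eq_bigr => i _; rewrite mxE. Qed.

Lemma dot_orthogonal (Q : 'M[R]_n) x y :
  Q *m Q^T = 1%:M -> dot (x *m Q) (y *m Q) = dot x y.
Proof.
by move=> QQ; rewrite !dotmxE trmx_mul mulmxA -(mulmxA x) QQ mulmx1.
Qed.

Lemma dot_delta x i : dot x (delta_mx 0 i) = x ord0 i.
Proof.
rewrite /dot (bigD1 i) //= big1 ?mxE ?eqxx ?mulr1 ?addr0 //.
by move=> j /negbTE ji; rewrite mxE ji andbF mulr0.
Qed.

Lemma dot_sumr x (I : finType) (F : I -> 'rV[R]_n) :
  dot x (\sum_i F i) = \sum_i dot x (F i).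
Proof.
apply: (big_morph (dot x)) => [y z|]; first exact: dotDr.
by rewrite dotC dot0l.
Qed.

(** After subtracting [f 0] the map preserves inner products, so the images of the standard basis
    are the rows of an orthogonal [Q]. Then [g x] and [x *m Q] have equal norms and inner product
    [dot x x], hence coincide. *)
Lemma isometry_rigid_motion (f : 'rV[R]_n -> 'rV[R]_n) :
  (forall x y, enorm (f x - f y) = enorm (x - y)) -> rigid_motion f.
Proof.
move=> iso; pose g x := f x - f 0.
have gg x y : dot (g x - g y) (g x - g y) = dot (x - y) (x - y).
  rewrite -!sqr_enorm -(iso x y); congr (enorm _ ^+ 2).
  by rewrite /g opprB addrA subrK.
have g0 x : dot (g x) (g x) = dot x x.
  by have := gg x 0; rewrite /g subrr !subr0.
have dotg x y : dot (g x) (g y) = dot x y.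
  move: (g0 x) (g0 y) (gg x y); move: (g x) (g y) => p q.
  rewrite !dotE (dotC q) (dotC y); lra.
pose Q : 'M[R]_n := \matrix_(i, j) g (delta_mx 0 i) ord0 j.
have rQ i : row i Q = g (delta_mx 0 i) by apply/rowP => j; rewrite !mxE.
have QQ : Q *m Q^T = 1%:M.
  apply/matrixP => i j.
  rewrite (_ : (Q *m Q^T) i j = dot (row i Q) (row j Q)); last first.
    by rewrite mxE; apply: eq_bigr => k _; rewrite !mxE.
  by rewrite !rQ dotg dot_delta !mxE eqxx eq_sym.
exists Q, (f 0); split=> // x.
apply/eqP; rewrite -subr_eq0 opprD addrA addrAC -/(g x); apply/eqP/dot_eq0.
have gQ : dot (g x) (x *m Q) = dot x x.
  rewrite mulmx_sum_row dot_sumr; apply: eq_bigr => i _.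
  by rewrite dotZr rQ dotg dot_delta.
have xQ := dot_orthogonal x x QQ; have := g0 x; move: gQ xQ.
move: (g x) (x *m Q) => p q pq qq pp; rewrite !dotE (dotC q) pq qq pp; ring.
Qed.

Lemma rigid_motion_surj (f : 'rV[R]_n -> 'rV[R]_n) :
  rigid_motion f -> forall y, exists x, f x = y.
Proof.
move=> [Q [a [QQ fE]]] y; exists ((y - a) *m Q^T).
by rewrite fE -mulmxA (mulmx1C QQ) mulmx1 subrK.
Qed.

End RigidMotions.

(** * From the action on points and unit balls to all ball-bodies *)

Theorem theorem1 (R : realType) (n : nat) (n_ge1 : (1 <= n)%N)
  (T : set 'rV[R]_n -> set 'rV[R]_n)
  (T_ball_body : forall K, ball_body K -> ball_body (T K))
  (T_isometry : forall K L, ball_body K -> ball_body L ->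
     hausdorff_dist (T K) (T L) = hausdorff_dist K L) :
  exists g : 'rV[R]_n -> 'rV[R]_n, rigid_motion g /\
    ((forall K, ball_body K -> T K = g @` K) \/
     (forall K, ball_body K -> T K = g @` cdual K)).
Proof.
have b1 (x : 'rV[R]_n) : ball_body [set x] by exact: ball_body_set1.
have bb (x : 'rV[R]_n) : ball_body (uball x) by exact: ball_body_uball.
have /choice[f hf] (x : 'rV[R]_n) : exists p,
    (T [set x] = [set p] /\ T (uball x) = uball p) \/
    (T [set x] = uball p /\ T (uball x) = [set p]).
  apply: far_pair_point_ball => //; try exact: T_ball_body.
    by rewrite T_isometry // hausdorff_dist_1b // subrr enorm0 add0r.
  (* The far companions are the images of the point and ball translated by [D *: u]. *)
  move=> D D0; have [u u1] := @unit_exists R n n_ge1.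
  have xD : enorm (x - (x + D *: u)) = D.
    by rewrite opprD addrA subrr add0r enormN enormZ u1 mulr1 gtr0_norm.
  exists (T [set x + D *: u]), (T (uball (x + D *: u))); split.
  - exact: T_ball_body.
  - exact: T_ball_body.
  - rewrite !T_isometry // (hausdorff_distC (uball _) [set _]).
    rewrite !hausdorff_dist_1b // hausdorff_dist_11 // hausdorff_dist_bb //.
    by rewrite subrr enorm0 add0r (enormB _ x) xD.
(* Mixed behaviour would give both [enorm (f x - f y) + 1 = enorm (x - y)] and
   [enorm (f x - f y) = enorm (x - y) + 1]. *)
have no_mix x y : T [set x] = [set f x] -> T (uball x) = uball (f x) ->
    T [set y] = uball (f y) -> T (uball y) = [set f y] -> False.
  move=> Tx _ Ty Tby.
  have := T_isometry _ _ (b1 x) (b1 y); have := T_isometry _ _ (b1 x) (bb y).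
  by rewrite Tx Ty Tby !hausdorff_dist_1b // !hausdorff_dist_11 //; lra.
case: (hf 0) => -[T0 Tb0].
- have Tp x : T [set x] = [set f x].
    by case: (hf x) => -[] // T1 T2; case: (no_mix 0 x).
  have iso x y : enorm (f x - f y) = enorm (x - y).
    by rewrite -!hausdorff_dist_11 // -!Tp T_isometry.
  have rf := isometry_rigid_motion iso; exists f; split=> //; left=> K bK.
  (* Surjectivity of [f] writes every centre as [f d], and the ball around [f d] contains [T K]
     exactly when the ball around [d] contains [K]. *)
  have mem y : T K (f y) <-> K y.
    split=> [/(ball_bodyE (T_ball_body _ bK)) h|/(ball_bodyE bK) h].
      apply/(ball_bodyE bK) => c /(subset_uballP n_ge1 c bK) Kc.
      rewrite -iso; apply: h; apply/(subset_uballP n_ge1 _ (T_ball_body _ bK)).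
      by rewrite -Tp T_isometry.
    apply/(ball_bodyE (T_ball_body _ bK)) => c.
    have [d <-] := rigid_motion_surj rf c.
    move=> /(subset_uballP n_ge1 _ (T_ball_body _ bK)).
    rewrite -Tp T_isometry // iso => Kd; apply: h.
    exact/(subset_uballP n_ge1 _ bK).
  apply/seteqP; split=> [y|_ [y Ky <-]]; last exact/mem.
  by have [x <-] := rigid_motion_surj rf y => /mem Kx; exists x.
- have Tp x : T (uball x) = [set f x].
    by case: (hf x) => -[] // T1 T2; case: (no_mix x 0).
  have iso x y : enorm (f x - f y) = enorm (x - y).
    by rewrite -hausdorff_dist_11 // -!Tp T_isometry // hausdorff_dist_bb.
  have rf := isometry_rigid_motion iso; exists f; split=> //; right=> K bK.
  (* Now [f d] is the image of the unit ball around [d], so the ball around [f d] contains [T K]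
     exactly when [d] is in [K]. *)
  have mem y : T K (f y) <-> cdual K y.
    rewrite cdualE //; split=> [/(ball_bodyE (T_ball_body _ bK)) h x Kx|h].
      apply/uballE; rewrite -iso.
      apply: h; apply/(subset_uballP n_ge1 _ (T_ball_body _ bK)).
      by rewrite -Tp T_isometry //; apply/center_memP.
    apply/(ball_bodyE (T_ball_body _ bK)) => c.
    have [d <-] := rigid_motion_surj rf c.
    move=> /(subset_uballP n_ge1 _ (T_ball_body _ bK)).
    rewrite -Tp T_isometry // iso => /(center_memP n_ge1 d bK) Kd.
    exact/uballE/h.
  apply/seteqP; split=> [y|_ [y Ky <-]]; last exact/mem.
  by have [x <-] := rigid_motion_surj rf y => /mem Kx; exists x.
Qed.
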